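(* Let $p\in\mathbb R_+^M$ be a price vector, let $X^*$ be the unique minimal maximizer of the over-demand function $\mathcal O(\cdot;p)$, and let $d\in\mathbb R_+^M$ be a direction with $\operatorname{supp}_+(d)=X^*$. Then there is $\delta>0$ such that for any $\varepsilon\in(0,\delta)$ the following are equivalent: (a) $d$ satisfies (LSC) at $p$; (b) $X^*$ is the unique minimizer of $s(X)+\check\rho(X^*\setminus X;p+\varepsilon d)$ among all subsets $X\subseteq X^*$; (c) $s(X)<\check\rho(X;p+\varepsilon d)$ holds for every non-empty subset $X\subseteq X^*$.
   Context: **Market model.** $M=\{1,\dots,m\}$ is the set of goods, $N=\{1,\dots,n\}$ with $n\ge 2$ the set of buyers, $s\in\mathbb Z_+^M$ the supply vector, and $[\mathbf 0,s]_{\mathbb Z}=\{x\in\mathbb Z_+^M : x\le s\}$ (vector inequalities are componentwise). For $x\in\mathbb R^M$ and $X\subseteq M$ put $x(X)=\sum_{j\in X}x_j$; $\chi_X\in\{0,1\}^M$ is the characteristic vector of $X$, $\chi_j=\chi_{\{j\}}$, $\chi_0=\mathbf 0$; $\operatorname{supp}_+(x)=\{j:x_j>0\}$, $\operatorname{supp}_-(x)=\{j:x_j<0\}$. Each buyer $i$ has a valuation $v_i:[\mathbf 0,s]_{\mathbb Z}\to\mathbb R_+$ with $v_i(\mathbf 0)=0$, monotone ($x\le y\Rightarrow v_i(x)\le v_i(y)$), and $\mathrm M^\natural$-concave: for all $x,x'\in[\mathbf 0,s]_{\mathbb Z}$ and $j\in\operatorname{supp}_+(x-x')$ there is $k\in\operatorname{supp}_-(x-x')\cup\{0\}$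 with $v_i(x)+v_i(x')\le v_i(x-\chi_j+\chi_k)+v_i(x'+\chi_j-\chi_k)$ (with $v_i=-\infty$ outside $[\mathbf 0,s]_{\mathbb Z}$). For each $(i,j)\in N\times M$ there is a payment function $q_{ij}:\mathbb R_+\to\mathbb R_+$ that is continuous, piecewise-linear (specified by finitely many breakpoints and slopes), strictly increasing, with $q_{ij}(0)=0$, and such that $q_{ij}(\kappa)=v_i(\chi_j)$ for some $\kappa\in\mathbb R_+$. For a price vector $p\in\mathbb R_+^M$, $u_i(x;p)=v_i(x)-\sum_{j\in M}q_{ij}(p_j)x_j$, $D_i(p)=\arg\max_{x\in[\mathbf 0,s]_{\mathbb Z}}u_i(x;p)$, and $\check D_i(p)$ is the set of (componentwise) minimal elements of $D_i(p)$. **Rank and over-demand functions.** $\check\rho_i(X;p)=\max\{x(X):x\in\check D_i(p)\}$, $\check\rho(X;p)=\sum_{i\in N}\check\rho_i(X;p)$, $\mu_i(X;p)=\min\{x(X):x\in D_i(p)\}$, and $\mathcal O(X;p)=\sum_{i\in N}\mu_i(X;p)-s(X)$ for $X\subseteq M$. The function $\mathcal O(\cdot;p)$ is supermodular, so it has a unique inclusion-minimal maximizer. **Local Stability Condition (LSC).** A direction $d\in\mathbb R_+^M$ satisfies (LSC) at $p$ if there is $\delta'>0$ such that for every $\varepsilon'\in[0,\delta')$ the set $\operatorname{supp}_+(d)$ is the unique minimal maximizer of $\mathcal O(\cdot;p+\varepsilon' d)$. *)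

(* Defs.v *)
From HB Require Import structures.
From mathcomp Require Import all_boot all_order all_algebra.
From mathcomp Require Import all_classical all_reals all_analysis.

Set Implicit Arguments.
Unset Strict Implicit.
Unset Printing Implicit Defensive.

Import Order.TTheory GRing.Theory Num.Theory.
Import numFieldNormedType.Exports.

Local Open Scope classical_set_scope.
Local Open Scope ring_scope.

Definition supp_pos (K : numDomainType) (m : nat) (z : 'rV[K]_m) : {set 'I_m} :=
  [set j | 0 < z ord0 j]%SET.

Definition supp_neg (K : numDomainType) (m : nat) (z : 'rV[K]_m) : {set 'I_m} :=
  [set j | z ord0 j < 0]%SET.

Definition nonneg_vec (K : numDomainType) (m : nat) (z : 'rV[K]_m) : Prop :=
  forall j, 0 <= z ord0 j.

(* The integer box [0, s], as a finite type. *)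
Definition bundle (m : nat) (s : 'I_m -> nat) : finType :=
  {dffun forall j : 'I_m, 'I_(s j).+1}.

Definition bundle0 (m : nat) (s : 'I_m -> nat) : bundle s :=
  [ffun j : 'I_m => (ord0 : 'I_(s j).+1)].

Definition bundle_le (m : nat) (s : 'I_m -> nat) (x y : bundle s) : bool :=
  [forall j, (x j <= y j)%N].

Definition bundle_vec (m : nat) (s : 'I_m -> nat) (x : bundle s) : 'rV[int]_m :=
  \row_j (x j : nat)%:Z.

Definition bundle_sum (m : nat) (s : 'I_m -> nat) (x : bundle s)
    (X : {set 'I_m}) : nat :=
  (\sum_(j in X) x j)%N.

Definition supply_sum (m : nat) (s : 'I_m -> nat) (X : {set 'I_m}) : nat :=
  (\sum_(j in X) s j)%N.

Definition chi (m : nat) (j : 'I_m) : 'rV[int]_m := delta_mx ord0 j.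

(* [None] stands for the extra index 0. *)
Definition chi0 (m : nat) (k : option 'I_m) : 'rV[int]_m :=
  if k is Some j then chi j else 0.

(* [f] on the box, and -oo elsewhere; [bundle_vec] is injective, so the bundle
   picked is the only candidate. *)
Definition box_ext (R : realType) (m : nat) (s : 'I_m -> nat)
    (f : bundle s -> R) (z : 'rV[int]_m) : \bar R :=
  if [pick x : bundle s | bundle_vec x == z] is Some x then (f x)%:E else -oo%E.

Definition Mnat_concave (R : realType) (m : nat) (s : 'I_m -> nat)
    (f : bundle s -> R) : Prop :=
  forall (x x' : bundle s) (j : 'I_m),
    j \in supp_pos (bundle_vec x - bundle_vec x') ->
  exists k : option 'I_m,
    (k \in None |: [set Some l | l in supp_neg (bundle_vec x - bundle_vec x')])%SET
    /\ ((f x)%:E + (f x')%:E <=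
          box_ext f (bundle_vec x - chi j + chi0 k)
        + box_ext f (bundle_vec x' + chi j - chi0 k))%E.

Record is_valuation (R : realType) (m : nat) (s : 'I_m -> nat)
    (f : bundle s -> R) : Prop := IsValuation {
  valuation_ge0 : forall x, 0 <= f x;
  valuation0 : f (bundle0 s) = 0;
  valuation_mono : forall x y, bundle_le x y -> f x <= f y;
  valuation_Mnat : Mnat_concave f
}.

(* On R_+, with breakpoints [0 :: t] and slopes [c]; the last piece is
   unbounded. *)
Definition piecewise_linear (R : realType) (f : R -> R) : Prop :=
  exists t c : seq R,
    [/\ sorted <%R (0 :: t), size c = (size t).+1 &
      forall (l : nat) (x : R), (l <= size t)%N ->
        (0 :: t)`_l <= x -> ((l < size t)%N -> x <= t`_l) ->
        f x = f (0 :: t)`_l + c`_l * (x - (0 :: t)`_l)].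

(* Functions R_+ -> R_+ are encoded as functions on R whose values at negative
   arguments are unconstrained. *)
Record is_payment (R : realType) (f : R -> R) : Prop := IsPayment {
  payment_ge0 : forall x, 0 <= x -> 0 <= f x;
  payment_continuous : {within `[0, +oo[, continuous f};
  payment_pl : piecewise_linear f;
  payment_incr : forall x y, 0 <= x -> x < y -> f x < f y;
  payment0 : f 0 = 0
}.

Definition utility (R : realType) (m : nat) (s : 'I_m -> nat)
    (v : bundle s -> R) (q : 'I_m -> R -> R) (x : bundle s) (p : 'rV[R]_m) : R :=
  v x - \sum_j q j (p ord0 j) * (x j : nat)%:R.

Definition demand (R : realType) (m : nat) (s : 'I_m -> nat)
    (v : bundle s -> R) (q : 'I_m -> R -> R) (p : 'rV[R]_m) : {set bundle s} :=
  [set x | [forall y, utility v q y p <= utility v q x p]]%SET.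

Definition min_demand (R : realType) (m : nat) (s : 'I_m -> nat)
    (v : bundle s -> R) (q : 'I_m -> R -> R) (p : 'rV[R]_m) : {set bundle s} :=
  [set x in demand v q p |
    [forall y in demand v q p, bundle_le y x ==> (y == x)]]%SET.

Definition rank1 (R : realType) (m : nat) (s : 'I_m -> nat)
    (v : bundle s -> R) (q : 'I_m -> R -> R) (X : {set 'I_m}) (p : 'rV[R]_m) : nat :=
  (\max_(x in min_demand v q p) bundle_sum x X)%N.

Definition rank (R : realType) (m n : nat) (s : 'I_m -> nat)
    (v : 'I_n -> bundle s -> R) (q : 'I_n -> 'I_m -> R -> R)
    (X : {set 'I_m}) (p : 'rV[R]_m) : nat :=
  (\sum_i rank1 (v i) (q i) X p)%N.

(* The default value [supply_sum s X] of the minimum bounds every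
   [bundle_sum x X], and [demand v q p] is never empty. *)
Definition min_req (R : realType) (m : nat) (s : 'I_m -> nat)
    (v : bundle s -> R) (q : 'I_m -> R -> R) (X : {set 'I_m}) (p : 'rV[R]_m) : nat :=
  \big[minn/supply_sum s X]_(x in demand v q p) bundle_sum x X.

Definition overdemand (R : realType) (m n : nat) (s : 'I_m -> nat)
    (v : 'I_n -> bundle s -> R) (q : 'I_n -> 'I_m -> R -> R)
    (p : 'rV[R]_m) (X : {set 'I_m}) : int :=
  (\sum_i min_req (v i) (q i) X p)%N%:Z - (supply_sum s X)%:Z.

Definition maximizers (m : nat) (f : {set 'I_m} -> int) : {set {set 'I_m}} :=
  [set X | [forall Y, f Y <= f X]]%SET.

Definition unique_minimal_maximizer (m : nat) (f : {set 'I_m} -> int)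
    (X : {set 'I_m}) : Prop :=
  [set Y : {set 'I_m} | minset [in maximizers f] Y]%SET = [set X]%SET.

Definition minimizers_in (m : nat) (A : {set 'I_m}) (f : {set 'I_m} -> nat) :
    {set {set 'I_m}} :=
  [set X in powerset A | [forall Y in powerset A, (f X <= f Y)%N]]%SET.

Definition LSC (R : realType) (m n : nat) (s : 'I_m -> nat)
    (v : 'I_n -> bundle s -> R) (q : 'I_n -> 'I_m -> R -> R)
    (p d : 'rV[R]_m) : Prop :=
  exists2 delta' : R, 0 < delta' &
    forall eps' : R, 0 <= eps' -> eps' < delta' ->
      unique_minimal_maximizer (overdemand v q (p + eps' *: d)) (supp_pos d).

(* Main.v *)
(* At p' = p + eps d with eps small, the demand D' of a buyer is constant in eps
   and consists of the elements of the demand D at p minimizing a linear cost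
   that is positive exactly on Xs. In an M-natural-convex set, a point that no
   exchange improves on Z minimizes x(Z). Hence x(Xs) is constant on D', equal
   to its minimum over D, and
   mu'(Z) + mu(Xs) <= mu'(Z cap Xs) + mu(Xs cup Z) for all Z, where mu and mu'
   are the minima over D and D'. Since Xs maximizes the over-demand O at p, this
   gives O(Z; p') <= O(Z cap Xs; p'), so only proper subsets of Xs compete with
   Xs at p', and for X included in Xs
   rank(X; p') - s(X) = O(Xs; p') - O(Xs \ X; p'). *)
Require Import Defs.
From mathcomp Require Import all_boot all_order all_algebra.
From mathcomp Require Import all_classical all_reals all_analysis.
From mathcomp Require Import zify lra ring.

Set Implicit Arguments.
Unset Strict Implicit.
Unset Printing Implicit Defensive.

Import Order.TTheory GRing.Theory Num.Theory.

Local Open Scope ring_scope.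

(** * Modular identities for sums over sets of goods *)

Section SetSums.
Variables (m : nat) (F : 'I_m -> nat).
Implicit Types X Z : {set 'I_m}.

Lemma sum_setD X Z : X \subset Z ->
  (\sum_(j in Z) F j = \sum_(j in X) F j + \sum_(j in Z :\: X) F j)%N.
Proof. by move=> /finset.setIidPr h; rewrite (big_setID X) /= h. Qed.

Lemma sum_setUI X Z :
  (\sum_(j in X :|: Z) F j + \sum_(j in Z :&: X) F j
   = \sum_(j in X) F j + \sum_(j in Z) F j)%N.
Proof.
rewrite (@sum_setD X) ?finset.subsetUl // finset.setDUl finset.setDv.
rewrite finset.set0U -addnA; congr addn.
by rewrite [RHS](big_setID X) /= addnC.
Qed.

End SetSums.

(** * Unit exchanges, M-natural-convex sets of bundles, and minima of x(X) *)

Section Moves.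
Variables (m : nat) (s : 'I_m -> nat).
Implicit Types (x y : bundle s) (X Z : {set 'I_m}) (S : {set bundle s}).

(** A relation, not a function, since x - chi_j + chi_k may leave the box; [k = None] discards the
    unit. *)
Definition move x (j : 'I_m) (k : option 'I_m) y : Prop :=
  bundle_vec y = bundle_vec x - chi j + chi0 k.

Lemma move_coord x j k y l : move x j k y ->
  (y l : nat)%:Z = (x l : nat)%:Z - (l == j)%:Z + (k == Some l)%:Z.
Proof.
rewrite /move /bundle_vec /chi.
case: k => [k|] /(congr1 (fun z : 'rV[int]_m => z ord0 l)).
  by rewrite /= /chi !mxE eqxx /= (inj_eq Some_inj) [k == l]eq_sym !natz => ->.
by rewrite /chi0 !mxE eqxx /= !natz => ->.
Qed.

(** Weights in an arbitrary ring serve both [bundle_sum] (indicators in [int]) and [cost] (real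
    weights). *)
Lemma sum_move (K : pzRingType) (w : 'I_m -> K) x j k y : move x j k y ->
  \sum_l w l * (y l : nat)%:R
  = \sum_l w l * (x l : nat)%:R - w j + oapp w 0 k.
Proof.
move=> hm.
have natZ (a : nat) : a%:R = (a%:Z)%:~R :> K by rewrite -pmulrn.
under eq_bigr => l _ do
  rewrite natZ (move_coord l hm) intrD intrB -!natZ mulrDr mulrBr.
rewrite big_split /= sumrB; congr (_ - _ + _).
  rewrite (bigD1 j) //= eqxx mulr1 big1 ?addr0 // => l /negbTE ->.
  by rewrite mulr0.
case: k {hm} => [k|] /=; last by rewrite big1 // => l _; rewrite mulr0.
rewrite (bigD1 k) //= eqxx mulr1 big1 ?addr0 // => l /negbTE hl.
by rewrite (inj_eq Some_inj) eq_sym hl mulr0.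
Qed.

Lemma bundle_sumE x X :
  (bundle_sum x X)%:Z = \sum_l (l \in X)%:Z * (x l : nat)%:R.
Proof.
rewrite /bundle_sum -natz natr_sum big_mkcond /=; apply: eq_bigr => l _.
by case: ifP => _; rewrite ?mul1r ?mul0r.
Qed.

Lemma bundle_sum_move X x j k y : move x j k y ->
  (bundle_sum y X)%:Z
  = (bundle_sum x X)%:Z - (j \in X)%:Z + oapp (fun l => (l \in X)%:Z) 0 k.
Proof. by move=> hm; rewrite !bundle_sumE (sum_move _ hm). Qed.

(** Exchange property of M-natural-convex sets. The second exchange y' = x' + chi_j - chi_k is
    written backwards, as a move from y' to x'. *)
Definition Mnat_convex S : Prop :=
  forall x x' j, x \in S -> x' \in S -> (x' j < x j)%N ->
  exists k y y', [/\ forall l, k = Some l -> (x l < x' l)%N,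
    y \in S, y' \in S, move x j k y & move y' j k x'].

Definition leaves (k : option 'I_m) Z := forall l, k = Some l -> l \notin Z.

(* Exchanging towards a hypothetical better [y] keeps [y(Z)] and brings [y]
   closer to [x] on [Z], unless it produces a forbidden move out of [x]. *)
Lemma Mnat_convex_local_min S Z x : Mnat_convex S -> x \in S ->
  (forall j k y, j \in Z -> leaves k Z -> y \in S -> ~ move x j k y) ->
  forall y, y \in S -> (bundle_sum x Z <= bundle_sum y Z)%N.
Proof.
move=> hS xS hx y.
(* Subtraction is truncated: the induction is on the total excess of [x] over [y] on [Z]. *)
have [n] := ubnP (\sum_(j in Z) (x j - y j))%N.
elim: n y => // n IHn y hn yS.
have [/existsP[j /andP[jZ hj]]|/existsPn hle] :=
  boolP [exists j, (j \in Z) && (y j < x j)%N]; last first.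
  by apply: leq_sum => j jZ; have := hle j; rewrite jZ /= -leqNgt.
have [k [x1 [y1 [hk x1S y1S hx1 hy1]]]] := hS x y j xS yS hj.
case: k => [k|] in hk hx1 hy1 *; last by case: (hx _ _ _ jZ _ x1S hx1).
have kZ : k \in Z.
  apply: contraPT hx1 => kZ; apply: hx jZ _ x1S => l [<-]; exact: kZ.
have -> : bundle_sum y Z = bundle_sum y1 Z.
  have := bundle_sum_move Z hy1; rewrite /= jZ kZ; lia.
apply: (IHn y1 _ y1S).
rewrite ltnS in hn; apply: leq_trans _ hn.
rewrite (bigD1 j) //= [in X in (_ < X)%N](bigD1 j) //=.
have hyl l := move_coord l hy1.
have hjk : j != k by apply: contraTneq (hk k erefl) => <-; rewrite -leqNgt ltnW.
have y1j : y1 j = (y j).+1 :> nat.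
  by have := hyl j; rewrite eqxx (inj_eq Some_inj) eq_sym (negbTE hjk); lia.
rewrite -addSn leq_add //; first by rewrite y1j subnSK.
apply: leq_sum => l /andP[_ lj]; have := hyl l.
rewrite (negbTE lj) (inj_eq Some_inj); case: eqP => [<-|_] hl.
  (* [y1] has one unit of [k] less than [y], but [x k < y k], so the truncated difference at [k] is
     still 0. *)
  have hyk : y k = (y1 k).+1 :> nat by lia.
  have := hk k erefl; rewrite hyk ltnS -subn_eq0 => /eqP ->.
  exact: leq0n.
by have -> : y1 l = y l :> nat by lia.
Qed.

(** [min_req] with the demand replaced by any set [S]; the two agree by conversion when [S] is a
    demand set. *)
Definition min_sum S X : nat :=
  \big[minn/supply_sum s X]_(x in S) bundle_sum x X.

Lemma min_sum_le S X x : x \in S -> (min_sum S X <= bundle_sum x X)%N.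
Proof. by move=> xS; rewrite -leEnat; apply: bigmin_le_cond. Qed.

Lemma min_sum_attained S X : S != finset.set0 ->
  exists2 x, x \in S & bundle_sum x X = min_sum S X.
Proof.
case/set0Pn => x0 x0S.
have [x xS hx] : exists2 x, x \in S &
    forall y, y \in S -> (bundle_sum x X <= bundle_sum y X)%N.
  case: (@arg_minnP _ x0 (mem S) (fun x => bundle_sum x X) x0S) => x xS hx.
  by exists x.
exists x => //; apply/eqP; rewrite eqn_leq min_sum_le // andbT.
rewrite /min_sum; elim/big_ind: _ => [|a b ha hb|y /hx //].
  by apply: leq_sum => j _; rewrite -ltnS ltn_ord.
by rewrite leq_min ha.
Qed.

(** Take a minimizer of x(X) with least total content: an element of [S] below it is again a
    minimizer, with no smaller total, hence equal to it. *)
Lemma min_sum_minimal S X : S != finset.set0 ->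
  exists x, [/\ x \in S, bundle_sum x X = min_sum S X &
    forall y, y \in S -> bundle_le y x -> y == x].
Proof.
move=> /(min_sum_attained X)[x0 x0S hx0].
pose P x := (x \in S) && (bundle_sum x X == min_sum S X).
have hP0 : P x0 by rewrite /P x0S hx0 /=.
case: (@arg_minnP _ x0 P (fun x => bundle_sum x [set: 'I_m]%SET) hP0).
move=> x /andP[xS /eqP hxX] hx; exists x; split => // y yS /forallP yx.
have hy : bundle_sum y X = min_sum S X.
  apply/eqP; rewrite eqn_leq min_sum_le // andbT -hxX.
  by apply: leq_sum => j _; exact: yx.
have := hx y; rewrite /P yS hy eqxx => /(_ isT) hxy.
apply/eqP/ffunP => j; apply: val_inj => /=.
have : bundle_sum x [set: 'I_m]%SET == bundle_sum y [set: 'I_m]%SET.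
  by rewrite eqn_leq hxy leq_sum // => l _; exact: yx.
rewrite eq_sym /bundle_sum.
have := @leqif_sum _ (mem [set: 'I_m]%SET) (fun j => y j == x j :> nat)
  (fun j => y j) (fun j => x j) (fun j _ => leqif_eq (yx j)).
move=> [_ ->] /forallP/(_ j)/implyP/(_ (finset.in_setT _))/eqP; exact.
Qed.

End Moves.

(** * Cost-minimal elements of an M-natural-convex set *)

Definition cost (K : pzRingType) (m : nat) (s : 'I_m -> nat) (w : 'I_m -> K)
    (x : bundle s) : K :=
  \sum_j w j * (x j : nat)%:R.

Section Perturbation.
Variables (R : realType) (m : nat) (s : 'I_m -> nat).
Variables (S S' : {set bundle s}) (Xs : {set 'I_m}) (w : 'I_m -> R).
Implicit Types (x y : bundle s) (X Z : {set 'I_m}).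
Hypothesis S_Mnat : Mnat_convex S.
Hypothesis S'_neq0 : S' != finset.set0.
Hypothesis w_gt0 : forall j, j \in Xs -> 0 < w j.
Hypothesis w_eq0 : forall j, j \notin Xs -> w j = 0.

(** [S] stands for a buyer's demand at [p], [S'] for the demand at the perturbed price, and [w] for
    the increments of the payments. *)
Hypothesis S'_argmin : forall x,
  (x \in S') = (x \in S) && [forall y in S, cost w x <= cost w y].

Let cost_min x y : x \in S' -> y \in S -> cost w x <= cost w y.
Proof. by rewrite S'_argmin => /andP[_ /forall_inP]; apply. Qed.

Let subS x : x \in S' -> x \in S.
Proof. by rewrite S'_argmin => /andP[]. Qed.

(** A move from [Z] to outside [Z] puts the unit where [w] vanishes, so it lowers the cost by [w j].
    For [j] in [Xs] this contradicts cost-minimality; otherwise the result stays in [S'] and is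
    excluded by assumption. Hence [x] is a local, so a global, minimizer on [Z]. *)
Lemma min_sum_argmin x Z : x \in S' -> Xs \subset Z ->
  (forall j k y, j \in Z -> j \notin Xs -> leaves k Z -> y \in S' ->
    ~ move x j k y) ->
  bundle_sum x Z = min_sum S Z.
Proof.
move=> xS' XsZ hx; have xS := subS xS'.
apply/eqP; rewrite eqn_leq min_sum_le // andbT.
have [|z zS <-] := @min_sum_attained _ _ S Z; first by apply/set0Pn; exists x.
apply: Mnat_convex_local_min zS => // j k y jZ hk yS hm.
have cost_y : cost w y = cost w x - w j.
  rewrite /cost (sum_move _ hm); case: k hk {hm} => [k|] hk /=; last exact: addr0.
  rewrite (w_eq0 (j := k)) ?addr0 //; apply: contra (hk k erefl).
  exact: (fintype.subsetP XsZ).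
have [jXs|jXs] := boolP (j \in Xs).
  have := cost_min xS' yS; rewrite cost_y; have := w_gt0 jXs; lra.
apply: hx hm => //; rewrite S'_argmin yS /=; apply/forall_inP => t tS.
by rewrite cost_y w_eq0 // subr0 cost_min.
Qed.

Lemma min_sum_Xs x : x \in S' -> bundle_sum x Xs = min_sum S Xs.
Proof. by move=> xS'; apply: min_sum_argmin => // j k y ->. Qed.

Lemma min_sum_Xs_argmin : min_sum S' Xs = min_sum S Xs.
Proof.
by have [x xS' <-] := min_sum_attained Xs S'_neq0; exact: min_sum_Xs.
Qed.

(* Among the elements of [S'] minimizing [x(Z :&: Xs)], take one with least
   [x(Z :\: Xs)]: it minimizes [x(Xs :|: Z)] over all of [S]. *)
Lemma min_sum_argminU Z :
  (min_sum S' Z + min_sum S Xs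
   <= min_sum S' (Z :&: Xs) + min_sum S (Xs :|: Z))%N.
Proof.
have [x0 x0S hx0] := min_sum_attained (Z :&: Xs) S'_neq0.
pose P x := (x \in S') && (bundle_sum x (Z :&: Xs) == min_sum S' (Z :&: Xs)).
have hP0 : P x0 by rewrite /P x0S hx0 /=.
case: (@arg_minnP _ x0 P (fun x => bundle_sum x (Z :\: Xs)) hP0).
move=> x /andP[xS' /eqP hxZ] hx.
have hU : bundle_sum x (Xs :|: Z) = min_sum S (Xs :|: Z).
  apply: min_sum_argmin => //; first exact: finset.subsetUl.
  move=> j k y jZ jXs hk yS' hm.
  (* The unit leaves [Xs :|: Z], so it enters no subset of it. With [j] in [Z] but not in [Xs], the
     move keeps x(Z :&: Xs) and lowers x(Z :\: Xs), against the choice of [x]. *)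
  have hk0 (Y : {set 'I_m}) : Y \subset Xs :|: Z -> oapp (fun l => (l \in Y)%:Z) 0 k
      = 0.
    move=> YZ; case: k hk {hm} => [k|] hk //=.
    by rewrite (negbTE (contra (fintype.subsetP YZ _) (hk k erefl))).
  have := bundle_sum_move (Z :&: Xs) hm.
  have := bundle_sum_move (Z :\: Xs) hm.
  rewrite !hk0; first last.
  - by apply: fintype.subset_trans (finset.subsetDl _ _) (finset.subsetUr _ _).
  - by apply: fintype.subset_trans (finset.subsetIl _ _) (finset.subsetUr _ _).
  move: jZ; rewrite !inE (negbTE jXs) /= andbF => ->.
  move=> hD hI; have /hx : P y by rewrite /P yS' -hxZ; apply/eqP; lia.
  lia.
have := sum_setUI (fun j => x j) Xs Z; rewrite -!/(bundle_sum x _).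
rewrite hU hxZ min_sum_Xs //.
by have := min_sum_le Z xS'; lia.
Qed.

(** Since x(Xs) is constant on [S'], maximizing x(X) amounts to minimizing x(Xs :\: X). The
    restriction to minimal bundles loses nothing, because some minimal bundle attains that
    minimum. *)
Lemma max_minimal_sum X : X \subset Xs ->
  (\max_(x in S' | [forall y in S', bundle_le y x ==> (y == x)]) bundle_sum x X
   + min_sum S' (Xs :\: X) = min_sum S' Xs)%N.
Proof.
move=> XXs; rewrite min_sum_Xs_argmin; apply/eqP; rewrite eqn_leq; apply/andP; split.
  have hle x : x \in S' -> (min_sum S' (Xs :\: X) + bundle_sum x X
      <= min_sum S Xs)%N.
    move=> xS'; rewrite -(min_sum_Xs xS') {2}/bundle_sum (sum_setD _ XXs) addnC.
    by rewrite leq_add2l; exact: min_sum_le.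
  have hD : (min_sum S' (Xs :\: X) <= min_sum S Xs)%N.
    have /set0Pn[x /hle] := S'_neq0; exact: leq_trans (leq_addr _ _).
  rewrite addnC -leq_subRL //; apply/bigmax_leqP => x /andP[xS' _].
  by rewrite leq_subRL // hle.
have [x [xS' hx hmin]] := min_sum_minimal (Xs :\: X) S'_neq0.
rewrite -(min_sum_Xs xS') /bundle_sum (sum_setD _ XXs) -!/(bundle_sum x _).
rewrite hx leq_add2r.
apply: leq_bigmax_cond; rewrite xS'; apply/forall_inP => y yS'.
by apply/implyP; exact: hmin.
Qed.

End Perturbation.

(** * Demand sets: exchange property and dependence on the price *)

Section Demand.
Variables (R : realType) (m : nat) (s : 'I_m -> nat).
Variables (v : bundle s -> R) (q : 'I_m -> R -> R).

Lemma utilityE x (p : 'rV[R]_m) :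
  utility v q x p = v x - cost (fun j => q j (p ord0 j)) x.
Proof. by []. Qed.

Lemma demandP x (p : 'rV[R]_m) :
  reflect (forall y, utility v q y p <= utility v q x p) (x \in demand v q p).
Proof. by rewrite inE; exact: forallP. Qed.

Lemma demand_neq0 (p : 'rV[R]_m) : demand v q p != finset.set0.
Proof.
apply/set0Pn.
case: (@arg_maxP _ _ _ (bundle0 s) predT (fun x => utility v q x p) isT).
by move=> x _ hx; exists x; apply/demandP => y; exact: hx.
Qed.

(** A real lower bound excludes the value -oo, so both points lie in the box. *)
Lemma box_ext_le (a : R) (f : bundle s -> R) (z z' : 'rV[int]_m) :
  (a%:E <= box_ext f z + box_ext f z')%E ->
  exists y y', [/\ bundle_vec y = z, bundle_vec y' = z' & a <= f y + f y'].
Proof.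
rewrite /box_ext; case: pickP => [y /eqP hy|_] //.
case: pickP => [y' /eqP hy'|_] //.
by rewrite -EFinD lee_fin; exists y, y'.
Qed.

(** The price terms of the two exchanges cancel, so the new pair has at least the total utility of
    the old one; as both old bundles are optimal, so are both new ones. *)
Lemma demand_Mnat_convex (p : 'rV[R]_m) :
  Mnat_concave v -> Mnat_convex (demand v q p).
Proof.
move=> hv x x' j /demandP hx /demandP hx' hj.
have [|k [hk]] := hv x x' j.
  by rewrite inE !mxE subr_gt0 ltz_nat.
rewrite -EFinD => /box_ext_le [y [y' [hy hy' hle]]].
have mxy : move x j k y by [].
have mxy' : move y' j k x' by rewrite /move hy' addrAC subrK addrK.
have := hx y; have := hx' y'; have := hx' y; have := hx y'.
have := sum_move (fun j => q j (p ord0 j)) mxy.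
have := sum_move (fun j => q j (p ord0 j)) mxy'.
rewrite -!/(cost _ _) => c1 c2 h1 h2 h3 h4.
exists k, y, y'; split => //.
- move=> l kl; move: hk; rewrite kl !inE /= => /imsetP[l' + [->]].
  by rewrite inE !mxE subr_lt0 ltz_nat.
- apply/demandP => z; apply: le_trans (hx z) _; move: h1 h2 h3 h4.
  rewrite !utilityE; lra.
- apply/demandP => z; apply: le_trans (hx z) _; move: h1 h2 h3 h4.
  rewrite !utilityE; lra.
Qed.

(** Utility at [p'] is utility at [p] minus [cost w], and utility at [p] is constant on the demand
    at [p]. *)
Lemma demand_argmin (p p' : 'rV[R]_m) : demand v q p' \subset demand v q p ->
  let w j := q j (p' ord0 j) - q j (p ord0 j) in
  forall x, (x \in demand v q p') = (x \in demand v q p)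
    && [forall y in demand v q p, cost w x <= cost w y].
Proof.
move=> /fintype.subsetP hsub w.
have hu x : utility v q x p' = utility v q x p - cost w x.
  rewrite !utilityE -addrA -opprD /cost -big_split /=; congr (_ - _).
  by apply: eq_bigr => j _; rewrite /w; ring.
move=> x; apply/idP/idP => [xS'|/andP[/demandP xS /forall_inP hx]].
  rewrite hsub //=; apply/forall_inP => y yS.
  have /demandP/(_ y) := xS'; rewrite !hu.
  have /demandP/(_ y) := hsub _ xS'; have /demandP/(_ x) := yS; lra.
(* An optimal [z] at [p'] also lies in the demand at [p]; [x] does at least as well as [z], hence as
   any bundle of the box. *)
have /set0Pn[z zS'] := demand_neq0 p'.
apply/demandP => y; have /demandP/(_ y) := zS'; rewrite !hu.
have := hx z (hsub _ zS'); have := xS z; lra.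
Qed.

End Demand.

(** * Eventual behaviour for small positive steps *)

Section NearRight.
Local Open Scope classical_set_scope.
Variable R : realType.
Implicit Types (f : R -> R) (a b d : R).

Lemma piecewise_linear_right f a d : piecewise_linear f -> 0 <= a -> 0 <= d ->
  exists c, \forall e \near 0^'+, f (a + e * d) = f a + e * c.
Proof.
move=> [t [cs [_ _ hf]]] a0 d0.
pose l := find (fun y => a < y) t.
have hl : (l <= size t)%N by exact: find_size.
have lel : (0 :: t)`_l <= a.
  rewrite /l; case E: (find _ t) => [|k] //=.
  by rewrite leNgt (@before_find _ 0 (fun y => a < y)) // E.
have ltl : (l < size t)%N -> a < t`_l.
  by move=> h; apply: (@nth_find _ 0 (fun y => a < y)); rewrite has_find.
have near_le : \forall e \near 0^'+, (l < size t)%N -> a + e * d <= t`_l.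
  have [{}/ltl hlt|_] := boolP (l < size t)%N; last exact: nearW.
  (* [d + 1] keeps the denominator positive when [d = 0]. *)
  have r0 : 0 < (t`_l - a) / (d + 1) by rewrite divr_gt0 ?subr_gt0 //; lra.
  near=> e => _.
  have e0 : 0 < e by near: e; exact: nbhs_right_gt.
  have : e <= (t`_l - a) / (d + 1) by near: e; exact: nbhs_right_le.
  rewrite ler_pdivlMr; nra.
exists (cs`_l * d); near=> e.
have e0 : 0 < e by near: e; exact: nbhs_right_gt.
have ed0 : 0 <= e * d by rewrite mulr_ge0 // ltW.
rewrite (hf l (a + e * d)) ?(hf l a) //; first ring.
- by move=> /ltl/ltW.
- by rewrite -[X in X <= _]addr0 lerD.
- by near: e.
Unshelve. all: by end_near. Qed.

(** The sign of [a] decides, and the sign of [b] when [a = 0]. The first clause says that a weak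
    inequality valid for small positive [e] persists at [e = 0]. *)
Lemma near_right_sign a b :
  exists c : bool, (c -> a <= 0) /\ \forall e \near 0^'+, (a + e * b <= 0) = c.
Proof.
have near_lt (x y : R) : 0 < x -> \forall e \near 0^'+, e * y < x.
  move=> x0; have r0 : 0 < x / (`|y| + 1) by rewrite divr_gt0 // ltr_wpDl.
  near=> e.
  have e0 : 0 < e by near: e; exact: nbhs_right_gt.
  have : e < x / (`|y| + 1) by near: e; exact: nbhs_right_lt.
  have := ler_norm y; rewrite ltr_pdivlMr ?ltr_wpDl //; nra.
have [a0|a0|->] := ltgtP a 0.
- exists true; split => //; have na0 : 0 < - a by rewrite oppr_gt0.
  near=> e; have : e * b < - a by near: e; exact: near_lt.
  by move=> h; apply/idP; lra.
- exists false; split => //.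
  near=> e; have : e * - b < a by near: e; exact: near_lt.
  by move=> h; apply/negbTE; rewrite -ltNge; lra.
- exists (b <= 0); split => //; near=> e.
  by rewrite add0r pmulr_rle0 //; near: e; exact: nbhs_right_gt.
Unshelve. all: by end_near. Qed.

Lemma near_right_ex (P : R -> Prop) : (\forall e \near 0^'+, P e) ->
  exists2 delta, 0 < delta & forall e, 0 < e -> e < delta -> P e.
Proof.
move=> [r /= r0 hr]; exists r => // e e0 er; apply: hr => //=.
by rewrite sub0r normrN gtr0_norm.
Qed.

(** Utilities are eventually affine in [e], so each of the finitely many pairwise comparisons has an
    eventually constant outcome, and these outcomes determine the demand. Weak inequalities pass to
    [e = 0], which gives the inclusion. *)
Lemma demand_near_const (m : nat) (s : 'I_m -> nat) (v : bundle s -> R)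
    (q : 'I_m -> R -> R) (p d : 'rV[R]_m) :
  (forall j, piecewise_linear (q j)) -> nonneg_vec p -> nonneg_vec d ->
  exists2 D : {set bundle s}, D \subset demand v q p &
    \forall e \near 0^'+, demand v q (p + e *: d) = D.
Proof.
move=> hq hp hd.
have /choice[c hc] : forall j, exists c, \forall e \near 0^'+,
    q j (p ord0 j + e * d ord0 j) = q j (p ord0 j) + e * c.
  by move=> j; apply: piecewise_linear_right.
have hu : \forall e \near 0^'+, forall x,
    utility v q x (p + e *: d) = utility v q x p - e * cost c x.
  have hc' : \forall e \near 0^'+, forall j,
    q j (p ord0 j + e * d ord0 j) = q j (p ord0 j) + e * c j by exact: filter_forall.
  near=> e.
  have hce : forall j,
    q j (p ord0 j + e * d ord0 j) = q j (p ord0 j) + e * c j by near: e.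
  move=> x; rewrite !utilityE /cost mulr_sumr -addrA -opprD -big_split /=.
  congr (_ - _); apply: eq_bigr => j _; rewrite !mxE hce.
  by rewrite mulrDl mulrA.
pose gap (z : bundle s * bundle s) :=
  utility v q z.1 p - utility v q z.2 p.
have /choice[b hb] : forall z, exists b : bool, (b -> gap z <= 0) /\
    \forall e \near 0^'+, (gap z + e * (cost c z.2 - cost c z.1) <= 0) = b.
  by move=> z; exact: near_right_sign.
have hb' : \forall e \near 0^'+, forall z,
    (gap z + e * (cost c z.2 - cost c z.1) <= 0) = b z.
  by apply: filter_forall => z; exact: (hb z).2.
exists [set x | [forall y, b (y, x)]]%SET.
  apply/fintype.subsetP => x; rewrite inE => /forallP hx.
  by apply/demandP => y; have /(hb _).1 := hx y; rewrite subr_le0.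
near=> e.
have hbe : forall z,
    (gap z + e * (cost c z.2 - cost c z.1) <= 0) = b z by near: e.
have hue : forall x,
    utility v q x (p + e *: d) = utility v q x p - e * cost c x by near: e.
apply/finset.setP => x; rewrite !inE; apply: eq_forallb => y.
rewrite -hbe !hue -subr_le0 /gap /=; congr (_ <= _); ring.
Unshelve. all: by end_near. Qed.

End NearRight.

(** * Reformulations of the two uniqueness conditions *)

Section UniqueOptimizers.
Variable m : nat.
Implicit Types X Y Z : {set 'I_m}.

(** Every maximizer contains a minimal one, so uniqueness places [X] inside every maximizer. *)
Lemma unique_minimal_maximizerP (f : {set 'I_m} -> int) X :
  unique_minimal_maximizer f X <->
  (forall Y, f Y <= f X) /\ (forall Y, f Y = f X -> X \subset Y).
Proof.
have maxP Y : reflect (forall Z, f Z <= f Y) (Y \in maximizers f).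
  by rewrite inE; exact: forallP.
split=> [h|[hX hmin]].
  have : X \in [set Y : {set 'I_m} | minset [in maximizers f] Y]%SET.
    by rewrite h finset.in_set1.
  rewrite inE => /minsetp/maxP hX; split=> // Y hY.
  have Ymax : Y \in maximizers f by apply/maxP => Z; rewrite hY.
  have [Z hZ ZY] := minset_exists Ymax.
  have : Z \in [set X]%SET by rewrite -h inE.
  by rewrite finset.in_set1 => /eqP <-.
have Xmax : X \in maximizers f by exact/maxP.
apply/finset.setP => Y; rewrite !inE; apply/idP/eqP => [hY|->].
  have /maxP hY' := minsetp hY; apply/esym; apply: (minsetinf hY) => //.
  by apply: hmin; apply/eqP; rewrite eq_le hX hY'.
apply/minsetP; split=> // Z /maxP hZ ZX; apply/eqP.
rewrite finset.eqEsubset ZX; apply: hmin; by apply/eqP; rewrite eq_le hX hZ.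
Qed.

(** Passing from [Xs] to [Xs :\: X] changes the objective by r(X) - s(X), and every subset of [Xs]
    has the form [Xs :\: X]. *)
Lemma minimizers_in_eq1 (s : 'I_m -> nat) (r : {set 'I_m} -> nat) Xs :
  r finset.set0 = 0%N ->
  minimizers_in Xs (fun X => supply_sum s X + r (Xs :\: X))%N = [set Xs]%SET
  <-> (forall X, X != finset.set0 -> X \subset Xs -> (supply_sum s X < r X)%N).
Proof.
move=> r0; pose f X := (supply_sum s X + r (Xs :\: X))%N.
have fXs : f Xs = supply_sum s Xs by rewrite /f finset.setDv r0 addn0.
have fD X : X \subset Xs ->
    supply_sum s Xs = (supply_sum s (Xs :\: X) + supply_sum s X)%N.
  by move=> XXs; rewrite /supply_sum (sum_setD s XXs) addnC.
have DD X : X \subset Xs -> Xs :\: (Xs :\: X) = X.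
  by move=> XXs; rewrite finset.setDDr finset.setDv finset.set0U;
    exact/finset.setIidPr.
have minP X : reflect (X \subset Xs /\ forall Y, Y \subset Xs -> (f X <= f Y)%N)
    (X \in minimizers_in Xs f).
  rewrite inE powersetE; apply: (iffP andP) => -[XXs h]; split => //.
    by move=> Y YXs; move/forall_inP: h; apply; rewrite powersetE.
  by apply/forall_inP => Y; rewrite powersetE; exact: h.
split=> [h X X0 XXs|h].
  rewrite ltnNge; apply: contra X0 => hX.
  have /minP[_ hXs] : Xs \in minimizers_in Xs f by rewrite h finset.in_set1.
  (* If r(X) <= s(X), then [Xs :\: X] does no worse than [Xs]; uniqueness then makes [X] empty. *)
  have : Xs :\: X \in minimizers_in Xs f.
    apply/minP; split; first exact: finset.subsetDl.
    move=> Y /hXs; apply: leq_trans.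
    by rewrite fXs /f DD // (fD X) // leq_add2l.
  rewrite h finset.in_set1 => /eqP hD.
  by rewrite -(DD X XXs) hD finset.setDv.
apply/finset.setP => Y; rewrite finset.in_set1; apply/minP/eqP => [[YXs hY]|->].
  apply/eqP/negPn/negP => YneXs.
  have D0 : Xs :\: Y != finset.set0.
    apply: contra YneXs; rewrite finset.setD_eq0 => XsY.
    by rewrite finset.eqEsubset YXs.
  have := h _ D0 (finset.subsetDl _ _); have := hY Xs (fintype.subxx _).
  have := fD _ (finset.subsetDl Xs Y); rewrite DD // fXs /f; lia.
split=> // Z ZXs; have [->//|ZneXs] := eqVneq Z Xs.
have D0 : Xs :\: Z != finset.set0.
  apply: contra ZneXs; rewrite finset.setD_eq0 => XsZ.
  by rewrite finset.eqEsubset ZXs.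
have := h _ D0 (finset.subsetDl _ _).
have := fD _ (finset.subsetDl Xs Z); rewrite DD // fXs /f; lia.
Qed.

End UniqueOptimizers.

(** * Over-demand and rank at a price raised exactly on [Xs] *)

Section Market.
Variables (R : realType) (m n : nat) (s : 'I_m -> nat).
Variables (v : 'I_n -> bundle s -> R) (q : 'I_n -> 'I_m -> R -> R).
Variables (p p' : 'rV[R]_m) (Xs : {set 'I_m}).
Implicit Types X Z : {set 'I_m}.
Hypothesis v_Mnat : forall i, Mnat_concave (v i).
Hypothesis Xs_max : unique_minimal_maximizer (overdemand v q p) Xs.
Hypothesis demand_sub :
  forall i, demand (v i) (q i) p' \subset demand (v i) (q i) p.
Hypothesis p'_gt : forall i j, j \in Xs ->
  q i j (p ord0 j) < q i j (p' ord0 j).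
Hypothesis p'_eq : forall j, j \notin Xs -> p' ord0 j = p ord0 j.

Let w i j := q i j (p' ord0 j) - q i j (p ord0 j).

Let w_gt0 i j : j \in Xs -> 0 < w i j.
Proof. by rewrite subr_gt0; exact: p'_gt. Qed.

Let w_eq0 i j : j \notin Xs -> w i j = 0.
Proof. by rewrite /w => /p'_eq ->; rewrite subrr. Qed.

Lemma overdemand_Xs : overdemand v q p' Xs = overdemand v q p Xs.
Proof.
rewrite /overdemand; congr (Posz _ - _); apply: eq_bigr => i _.
exact: (min_sum_Xs_argmin (demand_Mnat_convex (v_Mnat i))
  (demand_neq0 _ _ _) (@w_gt0 i) (@w_eq0 i) (demand_argmin (demand_sub i))).
Qed.

(** The inequality of [min_sum_argminU] is summed over the buyers; the supply terms cancel by
    modularity. *)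
Lemma overdemandU Z :
  overdemand v q p' Z + overdemand v q p Xs
  <= overdemand v q p' (Z :&: Xs) + overdemand v q p (Xs :|: Z).
Proof.
have hs := sum_setUI s Xs Z; rewrite -!/(supply_sum s _) in hs.
have hi i : (min_req (v i) (q i) Z p' + min_req (v i) (q i) Xs p
    <= min_req (v i) (q i) (Z :&: Xs) p'
       + min_req (v i) (q i) (Xs :|: Z) p)%N.
  exact: (min_sum_argminU (demand_Mnat_convex (v_Mnat i))
    (demand_neq0 _ _ _) (@w_gt0 i) (@w_eq0 i) (demand_argmin (demand_sub i))).
have : (\sum_i min_req (v i) (q i) Z p' + \sum_i min_req (v i) (q i) Xs p
    <= \sum_i min_req (v i) (q i) (Z :&: Xs) p'
       + \sum_i min_req (v i) (q i) (Xs :|: Z) p)%N.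
  by rewrite -!big_split leq_sum.
rewrite /overdemand; lia.
Qed.

Lemma rank_overdemand X : X \subset Xs ->
  (rank v q X p')%:Z - (supply_sum s X)%:Z
  = overdemand v q p' Xs - overdemand v q p' (Xs :\: X).
Proof.
move=> XXs.
have hs := sum_setD s XXs; rewrite -!/(supply_sum s _) in hs.
have hi i : (rank1 (v i) (q i) X p' + min_req (v i) (q i) (Xs :\: X) p'
    = min_req (v i) (q i) Xs p')%N.
  rewrite -[RHS](max_minimal_sum (demand_Mnat_convex (v_Mnat i))
    (demand_neq0 _ _ _) (@w_gt0 i) (@w_eq0 i)
    (demand_argmin (demand_sub i)) XXs).
  by congr addn; apply: eq_bigl => x; rewrite inE.
have : (rank v q X p' + \sum_i min_req (v i) (q i) (Xs :\: X) p'
    = \sum_i min_req (v i) (q i) Xs p')%N.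
  by rewrite -big_split; apply: eq_bigr => i _; exact: hi.
rewrite /overdemand; lia.
Qed.

Lemma unique_minimal_maximizer_rank :
  unique_minimal_maximizer (overdemand v q p') Xs <->
  (forall X, X != finset.set0 -> X \subset Xs ->
    (supply_sum s X < rank v q X p')%N).
Proof.
split=> [/unique_minimal_maximizerP[hmax hmin] X X0 XXs|hX].
  have neq : overdemand v q p' (Xs :\: X) != overdemand v q p' Xs.
    apply: contra X0 => /eqP/hmin; rewrite finset.subsetD => /andP[_].
    rewrite -setI_eq0 => /eqP <-; rewrite finset.setIC.
    by apply/eqP/esym/finset.setIidPl.
  have := hmax (Xs :\: X); rewrite le_eqVlt (negbTE neq) /=.
  have := rank_overdemand XXs; lia.
have [Xs_ge _] := (unique_minimal_maximizerP _ _).1 Xs_max.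
(* Maximality of [Xs] at [p] bounds the over-demand of [Xs :|: Z] in [overdemandU]. *)
have hle Z : overdemand v q p' Z <= overdemand v q p' (Z :&: Xs).
  have := overdemandU Z; have := Xs_ge (Xs :|: Z); lia.
have hlt Z : ~~ (Xs \subset Z) ->
    overdemand v q p' (Z :&: Xs) < overdemand v q p' Xs.
  rewrite -finset.setD_eq0 => hD.
  have DXs := finset.subsetDl Xs Z.
  have := hX _ hD DXs; have := rank_overdemand DXs.
  (* [Z :&: Xs] is the complement in [Xs] of the non-empty set [Xs :\: Z], to which the rank
     condition applies. *)
  rewrite finset.setDDr finset.setDv finset.set0U finset.setIC; lia.
apply/unique_minimal_maximizerP; split=> Z.
  apply: le_trans (hle Z) _; have [XsZ|/hlt/ltW//] := boolP (Xs \subset Z).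
  by rewrite (finset.setIidPr XsZ).
move=> hZ; apply/negPn/negP => /hlt; have := hle Z; rewrite hZ; lia.
Qed.

End Market.

(** * Choice of delta and the equivalences *)

Theorem theorem3p10 (R : realType) (m n : nat) (hn : (2 <= n)%N)
    (s : 'I_m -> nat) (v : 'I_n -> bundle s -> R) (q : 'I_n -> 'I_m -> R -> R)
    (hv : forall i, is_valuation (v i))
    (hq : forall i j, is_payment (q i j))
    (hqv : forall i j (x : bundle s), bundle_vec x = chi j ->
      exists2 kappa : R, 0 <= kappa & q i j kappa = v i x)
    (p : 'rV[R]_m) (hp : nonneg_vec p)
    (Xs : {set 'I_m}) (hXs : unique_minimal_maximizer (overdemand v q p) Xs)
    (d : 'rV[R]_m) (hd : nonneg_vec d) (hdXs : supp_pos d = Xs) :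
  exists2 delta : R, 0 < delta &
    forall eps : R, 0 < eps -> eps < delta ->
      (LSC v q p d <->
       minimizers_in Xs
         (fun X => supply_sum s X + rank v q (Xs :\: X) (p + eps *: d))%N
       = [set Xs]%SET)
      /\
      (minimizers_in Xs
         (fun X => supply_sum s X + rank v q (Xs :\: X) (p + eps *: d))%N
       = [set Xs]%SET
       <->
       (forall X : {set 'I_m}, X != finset.set0 -> X \subset Xs ->
          (supply_sum s X < rank v q X (p + eps *: d))%N)).

Proof.
have /choice[D hD] : forall i, exists D : {set bundle s},
    D \subset demand (v i) (q i) p /\
    \forall e \near (0 : R)^'+%classic, demand (v i) (q i) (p + e *: d) = D.
  move=> i.
  have [Di ? ?] := demand_near_const (v i) (fun j => payment_pl (hq i j)) hp hd.
  by exists Di.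
have [delta delta0 hdelta] : exists2 delta : R, 0 < delta &
    forall e : R, 0 < e -> e < delta ->
      forall i, demand (v i) (q i) (p + e *: d) = D i.
  by apply: near_right_ex; apply: filter_forall => i; exact: (hD i).2.
(* Over-demand depends on the price only through the demands, which do not vary on (0, delta). *)
have od_const (e e' : R) : 0 < e -> e < delta -> 0 < e' -> e' < delta ->
    overdemand v q (p + e *: d) = overdemand v q (p + e' *: d).
  move=> e0 ed e'0 e'd; apply/funext => X; rewrite /overdemand.
  congr (Posz _ - _); apply: eq_bigr => i _.
  by rewrite /min_req (hdelta e) // (hdelta e').
exists delta => [|eps eps0 epsd]; first exact: delta0.
have LSC_max : LSC v q p d <->
    unique_minimal_maximizer (overdemand v q (p + eps *: d)) Xs.
  rewrite /LSC hdXs; split=> [[delta' delta'0 h]|h].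
    have m0 : 0 < Num.min delta delta' by rewrite lt_min delta0.
    have [e e0 /andP[ed ed']] : exists2 e : R, 0 < e & (e < delta) && (e < delta').
      (* Half the minimum lies in both ranges; constancy carries the property from there to
         [eps]. *)
      exists (Num.min delta delta' / 2); first by rewrite divr_gt0.
      by rewrite -lt_min; lra.
    rewrite (od_const _ _ eps0 epsd e0 ed); exact: h e (ltW e0) ed'.
  exists delta => [|e]; first exact: delta0.
  (* The value 0 is allowed in (LSC); there the claim is the hypothesis on [Xs] at [p]. *)
  rewrite le_eqVlt => /orP[/eqP <- _|e0 ed].
    by rewrite scale0r addr0; exact: hXs.
  by rewrite (od_const _ _ e0 ed eps0 epsd); exact: h.
have bc : minimizers_in Xs
      (fun X => supply_sum s X + rank v q (Xs :\: X) (p + eps *: d))%N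
    = [set Xs]%SET <-> (forall X : {set 'I_m}, X != finset.set0 ->
      X \subset Xs -> (supply_sum s X < rank v q X (p + eps *: d))%N).
  apply: (minimizers_in_eq1 s (r := fun X => rank v q X _)).
  rewrite /rank big1 // => i _; rewrite /rank1 big1 // => x _.
  by rewrite /bundle_sum finset.big_set0.
split; last exact: bc.
rewrite bc LSC_max; apply: (unique_minimal_maximizer_rank _ hXs).
- by move=> i; exact: valuation_Mnat (hv i).
- by move=> i; rewrite hdelta //; exact: (hD i).1.
- move=> i j; rewrite -hdXs inE => dj.
  (* Strictly increasing payments turn d_j > 0 into a positive payment increment on [Xs]. *)
  by apply: (payment_incr (hq i j)) => //; rewrite !mxE ltrDl mulr_gt0.
- move=> j; rewrite -hdXs inE -leNgt => dj; rewrite !mxE.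
  have -> : d ord0 j = 0 by apply/eqP; rewrite eq_le dj hd.
  by rewrite mulr0 addr0.
Qed.
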